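(* For every integer $n\ge1$, $$\tilde{A}_n(t,-1)=\begin{cases}1+t\sum_{k=1}^m\binom{m}{k}(1+t)^kA_k(t), & \text{if } n=2m,\\[2mm] 1+t\sum_{k=0}^m\binom{m}{k}(1+t)^k\bigl(A_k(t)+A_{k+1}(t)\bigr), & \text{if } n=2m+1,\end{cases}$$ where the convention $A_0(t)=0$ is used.
   Context: Let $\mathfrak S_n$ be the set of permutations of $[n]=\{1,\dots,n\}$. For $\pi=\pi_1\cdots\pi_n\in\mathfrak S_n$ let $\mathrm{des}(\pi)=|\{i\in[n-1]:\pi_i>\pi_{i+1}\}|$, $\mathrm{exc}(\pi)=|\{i\in[n-1]:\pi_i>i\}|$ and $\mathrm{maj}(\pi)=\sum_{i\in[n-1],\,\pi_i>\pi_{i+1}} i$. For $n\ge1$, the Eulerian polynomial is $A_n(t)=\sum_{\pi\in\mathfrak S_n}t^{\mathrm{des}(\pi)}$, and $$A_n(t,q)=\sum_{\pi\in\mathfrak S_n}t^{\mathrm{exc}(\pi)}q^{\mathrm{maj}(\pi)-\mathrm{exc}(\pi)},\qquad \tilde A_n(t,q)=1+t\sum_{m=1}^n{n\brack m}_qA_m(t,q),$$ where ${n\brack m}_q=\frac{(q;q)_n}{(q;q)_m(q;q)_{n-m}}$, $(q;q)_n=\prod_{i=1}^n(1-q^i)$, is the $q$-binomial coefficient (a polynomial in $q$). $\tilde A_n(t,-1)$ is the evaluation of $\tilde A_n(t,q)$ at $q=-1$. *)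

(* Defs.v *)
From mathcomp Require Import all_boot all_order all_fingroup all_algebra.
From mathcomp Require Import ring.

Set Implicit Arguments.
Unset Strict Implicit.
Unset Printing Implicit Defensive.

Import GRing.Theory.
Local Open Scope ring_scope.

(* One-line notation, with the paper's 1-based conventions: [oneline s i] is
   the i-th letter pi_i, for 1 <= i <= n, of the permutation pi of {1,...,n}
   that corresponds to the permutation s of 'I_n = {0,...,n-1}. *)
Definition oneline (n : nat) (s : 'S_n) (i : nat) : nat :=
  nth 0%N [seq (val (s j)).+1 | j <- enum 'I_n] i.-1.

Definition des (n : nat) (s : 'S_n) : nat :=
  count (fun i => oneline s i.+1 < oneline s i)%N (index_iota 1 n).

Definition exc (n : nat) (s : 'S_n) : nat :=
  count (fun i => i < oneline s i)%N (index_iota 1 n).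

Definition maj (n : nat) (s : 'S_n) : nat :=
  (\sum_(1 <= i < n | (oneline s i.+1 < oneline s i)%N) i)%N.

(* A_n(t); the value A_0(t) = 0 is a convention (the sum over 'S_0 would
   give 1). *)
Definition eulerian (n : nat) : {poly int} :=
  if n == 0%N then 0 else \sum_(s : 'S_n) 'X^(des s).

(* (q;q)_n *)
Definition qpoch (n : nat) : {poly int} := \prod_(1 <= i < n.+1) (1 - 'X^i).

(* The leading coefficient of the divisor is 1 or -1, so this is a genuine
   Euclidean division in Z[q]; [qbinomK] shows that it is exact. *)
Definition qbinom (n m : nat) : {poly int} :=
  (qpoch n %/ (qpoch m * qpoch (n - m)))%R.

(* Polynomials in t and q are elements of Z[q][t]: the outer indeterminate
   is t, the inner one is q. *)

(* The subtraction on nat is not truncated: see [exc_le_maj]. *)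
Definition eulerian_q (n : nat) : {poly {poly int}} :=
  \sum_(s : 'S_n) ('X^(maj s - exc s) : {poly int}) *: 'X^(exc s).

Definition eulerian_tilde (n : nat) : {poly {poly int}} :=
  1 + 'X * \sum_(1 <= m < n.+1) qbinom n m *: eulerian_q m.

(* Substitution of c for q *)
Definition eval_q (c : int) (p : {poly {poly int}}) : {poly int} :=
  map_poly (horner_eval c) p.

Lemma oneline_inj (n : nat) (s : 'S_n) (i j : nat) :
  (0 < i <= n)%N -> (0 < j <= n)%N -> oneline s i = oneline s j -> i = j.
Proof.
have E k (hk : (k < n)%N) : oneline s k.+1 = (val (s (Ordinal hk))).+1.
  rewrite /oneline /= (nth_map (Ordinal hk)) ?size_enum_ord //.
  by congr (val (s _)).+1; apply: val_inj; rewrite /= nth_enum_ord.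
case: i j => [|i] [|j] //= hi hj; rewrite !E => -[] /val_inj /perm_inj.
by case=> ->.
Qed.

Lemma oneline_le (n : nat) (s : 'S_n) (i : nat) : (oneline s i <= n)%N.
Proof.
rewrite /oneline; case: (ltnP i.-1 n) => hi; last first.
  by rewrite nth_default // size_map size_enum_ord.
by rewrite (nth_map (Ordinal hi)) ?size_enum_ord //; exact: ltn_ord.
Qed.

(* The last excedance k satisfies exc <= k, and is followed by a descent at
   some position j >= k, whence exc <= k <= j <= maj. *)
Lemma exc_le_maj (n : nat) (s : 'S_n) : (exc s <= maj s)%N.
Proof.
have [/eqP -> //|] := boolP (exc s == 0)%N; rewrite -lt0n => e0.
have [k0 [hk0 ek0]] : exists k, (0 < k < n)%N /\ (k < oneline s k)%N.
  move: e0; rewrite /exc -has_count => /hasP[k].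
  by rewrite mem_index_iota => *; exists k.
pose P k := (0 < k < n)%N && (k < oneline s k)%N.
have exP : exists k, P k by exists k0; rewrite /P hk0 ek0.
have bP k : P k -> (k <= n)%N by case/andP => /andP[_ /ltnW].
case: (ex_maxnP exP bP) => k /andP[/andP[k1 kn] ek] kmax.
have excE : (exc s <= k)%N.
  rewrite /exc -size_filter -[k in (_ <= k)%N](size_iota 1).
  apply: uniq_leq_size; first by rewrite filter_uniq // iota_uniq.
  move=> i; rewrite mem_filter mem_index_iota mem_iota => /andP[ei /andP[i0 iN]].
  by rewrite i0 add1n ltnS kmax // /P i0 iN ei.
apply: leq_trans excE _.
have des_after : exists2 j, (k <= j < n)%N & (oneline s j.+1 < oneline s j)%N.
  have [/hasP[j]|/hasPn nodes] := boolP (has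
      (fun j => (oneline s j.+1 < oneline s j)%N) (index_iota k n)).
    by rewrite mem_index_iota => *; exists j.
  have step j : (k <= j < n)%N -> (oneline s j < oneline s j.+1)%N.
    move=> hj; have := nodes j; rewrite mem_index_iota => /(_ hj).
    rewrite -leqNgt leq_eqVlt => /orP[/eqP E|//].
    case/andP: hj => kj jn; have j0 := leq_trans k1 kj.
    suff /n_Sn : j = j.+1 by [].
    by apply: oneline_inj E; rewrite ?j0 ?jn //= ltnW.
  have inc d : (k + d <= n)%N -> (k + d < oneline s (k + d))%N.
    elim: d => [|d IH]; first by rewrite addn0.
    rewrite addnS => h; apply: leq_ltn_trans (IH (ltnW h)) _.
    by rewrite step // leq_addr.
  have := inc (n - k)%N; rewrite subnKC ?(ltnW kn) // => /(_ (leqnn n)).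
  by rewrite ltnNge oneline_le.
have [j /andP[kj jn] dj] := des_after.
apply: (leq_trans kj); rewrite /maj (big_rem j) /=.
  by rewrite dj leq_addr.
by rewrite mem_index_iota jn (leq_trans k1 kj).
Qed.

Lemma qpochS (n : nat) : qpoch n.+1 = qpoch n * (1 - 'X^(n.+1)).
Proof. by rewrite /qpoch big_nat_recr. Qed.

Lemma lead_coef_qpoch (n : nat) : lead_coef (qpoch n) = (-1) ^+ n.
Proof.
elim: n => [|n IH]; first by rewrite /qpoch big_geq // lead_coef1.
rewrite qpochS lead_coefM IH [RHS]exprSr -[1 - _]opprB lead_coefN -polyC1.
by rewrite lead_coefXnsubC ?mulrN1.
Qed.

Lemma qpoch_dvd (a b : nat) : exists c, c * (qpoch a * qpoch b) = qpoch (a + b).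
Proof.
have q0 : qpoch 0 = 1 by rewrite /qpoch big_geq.
elim: a b => [|a IHa] b; first by exists 1; rewrite q0 !mul1r.
elim: b => [|b [c Ec]]; first by exists 1; rewrite q0 mulr1 mul1r addn0.
have [c' Ec'] := IHa b.+1; exists (c' + 'X^(a.+1) * c).
have -> : qpoch (a.+1 + b.+1) =
    (1 - 'X^(a.+1)) * qpoch (a + b.+1) + 'X^(a.+1) * (1 - 'X^(b.+1)) * qpoch (a.+1 + b).
  by rewrite addSn qpochS -addSn exprD addSnnS; ring.
by rewrite -Ec -Ec' !qpochS; ring.
Qed.

Lemma qbinomK (n m : nat) : (m <= n)%N ->
  qbinom n m * (qpoch m * qpoch (n - m)) = qpoch n.
Proof.
move=> mn; have [c] := qpoch_dvd m (n - m); rewrite subnKC // => Ec.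
rewrite /qbinom -Ec Pdiv.IdomainUnit.mulpK // lead_coefM !lead_coef_qpoch.
by rewrite unitrMl unitrX ?unitrN1.
Qed.

(* Main.v *)
Require Import Defs.
From mathcomp Require Import all_boot all_order all_fingroup all_algebra.
From mathcomp Require Import ring zify.

(* At q = -1 the polynomial A_n(t,q) is the sum over S_n of
   (-1)^maj (-t)^exc. A descent at an even position contributes no sign, so
   this weight is a product of local weights over the pairs of positions
   (2j-1, 2j). Exchanging the letters of such a pair negates the weight, unless
   one of the letters is 2j; in that case the weights of the two arrangements
   add up to (1+t) or (1+t)t, according to the sign of the difference between
   2j and the other letter. What remains is a sum over the permutations of the
   odd letters, whence A_n(t,-1) = (1+t)^floor(n/2) A_{ceil(n/2)}(t), with
   excedances in place of descents. The two statistics are equidistributed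
   because inserting a new largest letter, in the word or in a cycle, gives the
   same recurrence. The q-binomial coefficients at q = -1 are ordinary binomial
   coefficients or 0, by the q-Pascal rule. *)

Import GRing.Theory.
Local Open Scope ring_scope.

(** * The q-binomial coefficients at q = -1 *)

Lemma qpoch0 : qpoch 0 = 1.
Proof. by rewrite /qpoch big_geq. Qed.

Lemma qpoch_neq0 (n : nat) : qpoch n != 0.
Proof. by rewrite -lead_coef_eq0 lead_coef_qpoch signr_eq0. Qed.

Lemma size_qpoch_lt (m n : nat) : (m < n)%N -> (size (qpoch m) < size (qpoch n))%N.
Proof.
have sizeS k : size (qpoch k.+1) = (size (qpoch k) + k.+1)%N.
  have s1 : size (1 - 'X^(k.+1) : {poly int}) = k.+2.
    by rewrite -opprB size_polyN -polyC1 size_XnsubC.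
  by rewrite qpochS size_mul ?qpoch_neq0 ?s1 ?addnS // -size_poly_eq0 s1.
elim: n => // n IH; rewrite ltnS leq_eqVlt sizeS addnS ltnS.
case/predU1P => [-> | /IH /ltnW mn]; first exact: leq_addr.
exact: leq_trans mn (leq_addr _ _).
Qed.

Lemma qbinom0 (n : nat) : qbinom n 0 = 1.
Proof.
apply: (mulIf (qpoch_neq0 n)).
by have := qbinomK (leq0n n); rewrite subn0 qpoch0 !mul1r.
Qed.

Lemma qbinom_small (n m : nat) : (n < m)%N -> qbinom n m = 0.
Proof.
move=> nm; apply: divp_small.
(* Here [n - m] truncates to 0, so the divisor is [qpoch m], of larger degree. *)
by rewrite (eqP (ltnW nm)) qpoch0 mulr1 size_qpoch_lt.
Qed.

(** The q-Pascal rule. Over a common denominator it amounts to 1 - q^(n+1) = (1 - q^(m+1)) + q^(m+1)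
    (1 - q^(n-m)). The case [m = n] is apart because [qbinomK] does not apply to [qbinom n n.+1]. *)
Lemma qbinomS (n m : nat) :
  qbinom n.+1 m.+1 = qbinom n m + 'X^(m.+1) * qbinom n m.+1.
Proof.
have [nm | mn] := ltnP n m.
  by rewrite !qbinom_small ?mulr0 ?addr0 // ltnS ltnW.
have D0 : qpoch m.+1 * qpoch (n - m) != 0 by rewrite mulf_neq0 ?qpoch_neq0.
apply: (mulIf D0); rewrite -subSS qbinomK // mulrDl subSS.
have E1 : qbinom n m * (qpoch m.+1 * qpoch (n - m)) = qpoch n * (1 - 'X^(m.+1)).
  by rewrite -(qbinomK mn) qpochS; ring.
rewrite E1 qpochS; move: mn; rewrite leq_eqVlt => /predU1P[-> | mn].
  by rewrite (qbinom_small n n.+1) // mulr0 mul0r addr0.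
have -> : 'X^(m.+1) * qbinom n m.+1 * (qpoch m.+1 * qpoch (n - m)) =
    'X^(m.+1) * qpoch n * (1 - 'X^(n - m)).
  by rewrite -(qbinomK mn) -(subnSK mn) !qpochS; ring.
have -> : ('X^(n.+1) : {poly int}) = 'X^(m.+1) * 'X^(n - m).
  by rewrite -exprD addSn subnKC // ltnW.
by ring.
Qed.

(** In the q-Pascal rule at q = -1, odd [n] and odd [m] give the ordinary Pascal rule, odd [n] and
    even [m] a cancellation of equal terms; for even [n] one of the two terms vanishes. *)
Lemma qbinomN1 (n m : nat) :
  (qbinom n m).[-1] = ((~~ odd m || odd n) * 'C(n./2, m./2))%N%:R.
Proof.
elim: n m => [|n IH] [|m]; rewrite ?qbinom0 ?hornerE ?bin0 //.
  rewrite qbinom_small // horner0.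
  by case: m => [|m] //=; rewrite bin0n muln0.
rewrite qbinomS hornerD hornerM hornerXn !IH.
rewrite -signr_odd /= !uphalf_half.
case: (odd m) (odd n) => [] [] /=; rewrite ?add1n ?add0n ?binS ?natrD ?expr1 ?expr0;
 rewrite ?mul0n ?mul1n ?mul1r; try ring.
Qed.

(** * Equidistribution of descents and excedances *)

Lemma onelineE (n : nat) (s : 'S_n) (i : 'I_n) : oneline s i.+1 = (s i).+1.
Proof. by rewrite /oneline /= (nth_map i) ?size_enum_ord // nth_ord_enum. Qed.

Lemma excE (n : nat) (s : 'S_n) : exc s = (\sum_(i < n) (i < s i))%N.
Proof.
case: n s => [|n] s; first by rewrite big_ord0.
(* The last position is never an excedance, so it may be included. *)
have -> : exc s = count (fun i => i < oneline s i)%N (index_iota 1 n.+2).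
  rewrite /exc /index_iota !subn1 -[n.+2.-1]addn1 iotaD count_cat /= add1n.
  by rewrite ltnNge oneline_le !addn0.
rewrite -sum1_count big_mkcond big_add1 /= big_mkord.
by apply: eq_bigr => i _; rewrite onelineE ltnS; case: (i < s i)%N.
Qed.

(* The term [i = 0] vanishes because [oneline s 0 = oneline s 1], by the junk
   value of the predecessor. *)
Lemma desE (n : nat) (s : 'S_n) :
  des s = (\sum_(0 <= i < n) (oneline s i.+1 < oneline s i))%N.
Proof.
rewrite /des -sum1_count big_mkcond /=; case: n s => [|n] s; first by rewrite !big_geq.
rewrite [in RHS]big_ltn // ltnn add0n.
by apply: eq_bigr => i _; case: (_ < _)%N.
Qed.

(* Summing over the [n + 1] ways of inserting a new maximum: one of them and
   those with [b i] keep the statistic, the others raise it by one. *)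
Lemma insertion_sum (n c : nat) (b : 'I_n -> bool) :
    (\sum_(i < n) b i)%N = c ->
  'X^c + \sum_(i < n) 'X^(c + ~~ b i) =
    'X^c + 'X * (1 - 'X) * ('X^c)^`() + n%:R * 'X * 'X^c :> {poly int}.
Proof.
move=> <-; set c' := (\sum_(i < n) b i)%N.
have -> : \sum_(i < n) 'X^(c' + ~~ b i) =
    \sum_(i < n) ('X^c' * 'X + (b i)%:R * ('X^c' * (1 - 'X))) :> {poly int}.
  by apply: eq_bigr => i _; case: (b i); rewrite /= ?addn0 ?addn1 ?exprSr; ring.
rewrite big_split /= sumr_const card_ord -mulr_suml -natr_sum -/c' derivXn.
case: c' => [|c'']; first by rewrite mul0r mulr0n expr0 -[_ *+ n]mulr_natl; ring.
by rewrite -[_ *+ n]mulr_natl -['X^_ *+ _]mulr_natl exprS /=; ring.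
Qed.

(** Injectivity suffices, since (n+1) n! = (n+1)!. *)
Lemma insertion_bij (n : nat) (ins : 'I_n.+1 -> 'S_n -> 'S_n.+1)
    (F : 'S_n.+1 -> {poly int}) :
    injective (fun ps => ins ps.1 ps.2) ->
  \sum_(s : 'S_n.+1) F s = \sum_(s : 'S_n) \sum_(p : 'I_n.+1) F (ins p s).
Proof.
move=> inj_ins; rewrite exchange_big pair_big /=.
rewrite (reindex (fun ps => ins ps.1 ps.2)) //; apply: onW_bij.
by apply: inj_card_bij => //; rewrite card_prod !card_Sn card_ord.
Qed.

(** Products act left factor first: the new maximum comes right after [p] in its cycle, or is a
    fixed point if [p] is [ord_max]. *)
Definition insert_cycle {n : nat} (p : 'I_n.+1) (s : 'S_n) : 'S_n.+1 :=
  (tperm p ord_max * lift_perm ord_max ord_max s)%g.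

Definition insert_word {n : nat} (p : 'I_n.+1) (s : 'S_n) : 'S_n.+1 :=
  lift_perm p ord_max s.

Lemma lift_perm_inj (n : nat) (i j : 'I_n.+1) : injective (@lift_perm n i j).
Proof.
move=> s t st; apply/permP=> k; apply: (@lift_inj _ j).
by rewrite -!(lift_perm_lift i) st.
Qed.

Lemma insert_word_inj (n : nat) :
  injective (fun ps : 'I_n.+1 * 'S_n => insert_word ps.1 ps.2).
Proof.
move=> [p s] [q t]; rewrite /insert_word /= => E.
have pq : p = q.
  by apply: (@perm_inj _ (lift_perm p ord_max s)); rewrite {2}E !lift_perm_id.
by rewrite -pq in E *; rewrite (lift_perm_inj _ _ _ _ _ E).
Qed.

Lemma insert_cycle_inj (n : nat) :
  injective (fun ps : 'I_n.+1 * 'S_n => insert_cycle ps.1 ps.2).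
Proof.
move=> [p s] [q t]; rewrite /insert_cycle /= => E.
have pq : p = q.
  apply: (@perm_inj _ (insert_cycle p s)); rewrite {2}/insert_cycle E.
  by rewrite /insert_cycle !permM !tpermL !lift_perm_id.
by rewrite -pq in E *; rewrite (lift_perm_inj _ _ _ _ _ (mulgI _ _ _ E)).
Qed.

Lemma widen_ordE (n : nat) (i : 'I_n) : widen_ord (leqnSn n) i = lift ord_max i.
Proof. by apply: val_inj; rewrite /= /bump leqNgt ltn_ord. Qed.

Lemma exc_insert_max (n : nat) (s : 'S_n) : exc (insert_cycle ord_max s) = exc s.
Proof.
rewrite !excE big_ord_recr /= /insert_cycle tperm1 mul1g lift_perm_id ltnn addn0.
by apply: eq_bigr => i _; rewrite widen_ordE lift_perm_lift !lift_max.
Qed.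

(** Position [p] now carries the maximum, hence is an excedance whether or not it was one before;
    the last position receives the old image of [p] and is none. *)
Lemma exc_insert_lift (n : nat) (s : 'S_n) (p : 'I_n) :
  exc (insert_cycle (lift ord_max p) s) = (exc s + ~~ (p < s p))%N.
Proof.
rewrite !excE big_ord_recr /= /insert_cycle ltnNge leq_ord addn0.
rewrite (bigD1 p) // [in RHS](bigD1 p) //= widen_ordE permM tpermL lift_perm_id ltn_ord.
rewrite addnAC; congr addn; first by case: (p < s p)%N.
apply: eq_bigr => i ip; rewrite widen_ordE permM tpermD ?lift_perm_lift ?lift_max //.
  by rewrite (inj_eq (@lift_inj _ _)) eq_sym.
exact: neq_lift.
Qed.

Lemma oneline_insert (n : nat) (s : 'S_n) (p : 'I_n.+1) (i : nat) :
    (0 < i <= n.+1)%N ->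
  oneline (insert_word p s) i =
    if i == p.+1 then n.+1 else if (i <= p)%N then oneline s i else oneline s i.-1.
Proof.
case: i => // i /= hi; rewrite (onelineE _ _ (Ordinal hi)) eqSS.
have [k Ek | Ek] := unliftP p (Ordinal hi); last first.
  by rewrite Ek /insert_word lift_perm_id -(congr1 val Ek) /= eqxx.
rewrite Ek /insert_word lift_perm_lift lift_max -onelineE.
have -> : i = bump p k by exact: (congr1 val Ek).
rewrite /bump; case: (leqP p k) => pk; last by rewrite add0n (ltn_eqF pk) pk.
by rewrite add1n gtn_eqF // ifN // -leqNgt leqW.
Qed.

(** The maximum lands between the letters [p] and [p.+1] of the word: it destroys a possible descent
    there, and starts a descent unless it is the last letter. *)
Lemma sum_des_insert (n : nat) (s : 'S_n) (p : 'I_n.+1) :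
  des (insert_word p s) =
    (\sum_(0 <= i < p) (oneline s i.+1 < oneline s i) + (p < n) +
     \sum_(p.+1 <= i < n) (oneline s i.+1 < oneline s i))%N.
Proof.
have pn : (p <= n)%N by rewrite -ltnS.
have top : oneline (insert_word p s) p.+1 = n.+1 by rewrite oneline_insert ?eqxx.
rewrite desE (big_cat_nat (leq0n p) (leqW pn)) /= -addnA; congr addn.
  rewrite [LHS]big_nat_cond [RHS]big_nat_cond; apply: eq_bigr => -[|i] /andP[/andP[_ ip] _].
    by rewrite !ltnn.
  have ip' : (i < p)%N by apply: ltnW.
  have iN : (i.+1 < n)%N by apply: leq_trans ip pn.
  rewrite !oneline_insert ?ltnS ?(ltnW (ltnW iN)) ?(ltnW iN) //=.
  by rewrite ?eqSS ?(ltn_eqF ip) ?(ltn_eqF ip') ip ip'.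
rewrite big_ltn // top ltnNge oneline_le add0n.
have [pn' | np] := ltnP p n; last by rewrite !big_geq // ltnW.
have next : oneline (insert_word p s) p.+2 = oneline s p.+1.
  by rewrite oneline_insert // gtn_eqF // ifN // -leqNgt leqW.
rewrite big_ltn // top next ltnS oneline_le.
congr addn; rewrite big_add1 /= big_nat_cond [RHS]big_nat_cond.
apply: eq_bigr => i /andP[/andP[pi ni] _].
have ni' : (i < n)%N by apply: ni.
rewrite !oneline_insert ?ltnS //= ?(ltnW ni) //.
by rewrite !eqSS !gtn_eqF ?leqW // !ifN // -leqNgt ?leqW // ltnW.
Qed.

Lemma des_insert_max (n : nat) (s : 'S_n) : des (insert_word ord_max s) = des s.
Proof. by rewrite sum_des_insert ltnn addn0 [X in (_ + X)%N]big_geq // addn0 desE. Qed.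

Lemma des_insert (n : nat) (s : 'S_n) (p : 'I_n) :
  des (insert_word (lift ord_max p) s) =
    (des s + ~~ (oneline s p.+1 < oneline s p))%N.
Proof.
rewrite sum_des_insert lift_max ltn_ord desE [in RHS](big_cat_nat (leq0n p) (ltnW (ltn_ord p))) /=.
rewrite [in RHS](big_ltn (ltn_ord p)) -!addnA; congr addn.
by rewrite [RHS]addnCA addnA; case: (_ < _)%N; rewrite ?addn0 // addnC.
Qed.

(** The right-hand side depends on the statistic only through [P], so any two statistics with such
    insertions satisfy the same recurrence. [b s p] marks the insertions that preserve the
    statistic. *)
Lemma eulerian_insertion (n : nat) (st : forall k, 'S_k -> nat)
    (b : 'S_n -> 'I_n -> bool) (ins : 'I_n.+1 -> 'S_n -> 'S_n.+1) :
    injective (fun ps => ins ps.1 ps.2) ->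
    (forall s, st _ (ins ord_max s) = st _ s) ->
    (forall s p, st _ (ins (lift ord_max p) s) = (st _ s + ~~ b s p)%N) ->
    (forall s, st _ s = (\sum_(p < n) b s p)%N) ->
  let P := \sum_(s : 'S_n) 'X^(st _ s) : {poly int} in
  \sum_(s : 'S_n.+1) 'X^(st _ s) = P + 'X * (1 - 'X) * P^`() + n%:R * 'X * P.
Proof.
move=> inj_ins st_max st_lift stE /=.
rewrite (insertion_bij _ _ _ inj_ins) (raddf_sum (@deriv int)) !big_distrr -!big_split /=.
apply: eq_bigr => s _; rewrite big_ord_recr /= st_max addrC.
rewrite -(insertion_sum _ _ (b s)) //; congr (_ + _).
by apply: eq_bigr => p _; rewrite widen_ordE st_lift.
Qed.

Lemma sum_des_exc (n : nat) :
  \sum_(s : 'S_n) 'X^(des s) = \sum_(s : 'S_n) 'X^(exc s) :> {poly int}.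
Proof.
elim: n => [|n IH].
  by apply: eq_bigr => s _; rewrite excE desE big_ord0 big_geq.
have := eulerian_insertion n des (fun s p => oneline s p.+1 < oneline s p)%N
  insert_word (insert_word_inj n) (@des_insert_max n) (@des_insert n).
move=> -> /=; last by move=> s; rewrite desE big_mkord.
by rewrite IH (eulerian_insertion n exc (fun s p => p < s p)%N insert_cycle
  (insert_cycle_inj n) (@exc_insert_max n) (@exc_insert_lift n) (@excE n)).
Qed.

(** * Factorization over pairs of positions and cancellation *)

(* The contribution to [(-1)^maj (-t)^exc] of the letters [a], [b] in the
   positions [i], [i + 1], for odd [i]. *)
Definition pair_weight (i a b : nat) : {poly int} :=
  (-1) ^+ (b < a)%N * (- 'X) ^+ ((i < a) + (i.+1 < b))%N.

(** A letter other than [i.+1] exceeds [i] iff it exceeds [i.+1], so the exchange preserves the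
    number of excedances and only flips the sign. *)
Lemma pair_weightC (i a b : nat) : a != b -> a != i.+1 -> b != i.+1 ->
  pair_weight i b a = - pair_weight i a b.
Proof.
move=> ab ai bi; rewrite /pair_weight.
have Ea : (i < a)%N = (i.+1 < a)%N by rewrite (ltn_neqAle i.+1) eq_sym ai.
have Eb : (i < b)%N = (i.+1 < b)%N by rewrite (ltn_neqAle i.+1) eq_sym bi.
rewrite Ea Eb addnC; case: ltngtP ab => //= _ _; ring.
Qed.

(** The two weights are 1 and t if [u < i.+1], and t and t^2 if [u > i.+1]. *)
Lemma pair_weight_key (i u : nat) : u != i.+1 ->
  pair_weight i u i.+1 + pair_weight i i.+1 u = (1 + 'X) * 'X ^+ (i < u)%N.
Proof.
move=> ui; rewrite /pair_weight ltnSn ltnn.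
by case: (ltngtP u i.+1) ui => //= _ _; ring.
Qed.

Lemma prod_pairs (F : nat -> {poly int}) (m : nat) :
  \prod_(1 <= i < m.*2.+1) F i = \prod_(0 <= j < m) (F j.*2.+1 * F j.*2.+2).
Proof.
elim: m => [|m IH]; first by rewrite !big_geq.
rewrite [RHS]big_nat_recr //= -IH doubleS big_nat_recr //=.
by rewrite big_nat_recr //= mulrA.
Qed.

Lemma signed_exc_maj (n : nat) (s : 'S_n) :
  (-1) ^+ maj s * (- 'X) ^+ exc s =
  \prod_(0 <= j < n./2)
     pair_weight j.*2.+1 (oneline s j.*2.+1) (oneline s j.*2.+2).
Proof.
pose F i : {poly int} := (-1) ^+ (i * (oneline s i.+1 < oneline s i))%N
  * (- 'X) ^+ (i < oneline s i)%N.
have -> : (-1) ^+ maj s * (- 'X) ^+ exc s = \prod_(1 <= i < n) F i.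
  rewrite big_split /= !prodrXr /exc -sum1_count; congr (_ ^+ _ * _ ^+ _).
    by rewrite /maj big_mkcond; apply: eq_bigr => i _; case: (_ < _)%N; rewrite ?muln1 ?muln0.
  by rewrite big_mkcond; apply: eq_bigr => i _; case: (_ < _)%N.
(* For even [n] the right side has the extra factor [F n]. The default letter 0 at position [n.+1]
   creates a spurious descent at [n], but its sign is trivial because [n] is even. *)
have -> : \prod_(1 <= i < n) F i = \prod_(1 <= i < (n./2).*2.+1) F i.
  have := odd_double_half n; case: (boolP (odd n)) => [_ E|ev E].
    by rewrite {1}(esym E).
  rewrite add0n in E; rewrite E; have [n0 | n0] := posnP n.
    by rewrite [X in \prod_(1 <= i < X) _ = _]n0 !big_geq // n0.
  rewrite [RHS]big_nat_recr //=; suff -> : F n = 1 by rewrite mulr1.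
  by rewrite /F [(n < _)%N]ltnNge oneline_le mulr1 exprM -signr_odd (negbTE ev) expr1n.
rewrite prod_pairs; apply: eq_bigr => j _.
have even_sign : (-1) ^+ (j.*2.+2 * (oneline s j.*2.+3 < oneline s j.*2.+2))%N = 1 :> {poly int}.
  by rewrite -signr_odd oddM /= odd_double.
have odd_sign b : (-1) ^+ (j.*2.+1 * b)%N = (-1) ^+ b :> {poly int}.
  by rewrite -signr_odd oddM /= odd_double signr_odd.
by rewrite /F /pair_weight even_sign mul1r odd_sign exprD mulrA.
Qed.

Lemma eval_eulerian_q (n : nat) :
  eval_q (-1) (eulerian_q n) = \sum_(s : 'S_n) \prod_(0 <= j < n./2)
     pair_weight j.*2.+1 (oneline s j.*2.+1) (oneline s j.*2.+2).
Proof.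
rewrite /eval_q /eulerian_q rmorph_sum; apply: eq_bigr => s _.
rewrite -signed_exc_maj /= map_polyZ map_polyXn /= horner_evalE hornerXn.
rewrite -mul_polyC rmorphXn rmorphN1 [(- 'X) ^+ _]exprNn mulrA -exprD; congr (_ * _).
(* The exponents [maj s + exc s] and [maj s - exc s] differ by the even number [2 * exc s]. *)
by rewrite -{2}(subnK (exc_le_maj s)) -addnA addnn exprD -[_ ^+ (exc s).*2]signr_odd odd_double mulr1.
Qed.

Lemma oneline_tperm (n : nat) (s : 'S_n) (i i' : 'I_n) (x : nat) : (x < n)%N ->
  oneline (tperm i i' * s)%g x.+1 =
    oneline s (if x == i :> nat then i' : nat else if x == i' :> nat then i : nat else x).+1.
Proof.
move=> xn; rewrite (onelineE _ _ (Ordinal xn)) permM.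
case: tpermP => [<-|<-|/eqP xi /eqP xi']; rewrite ?eqxx -?onelineE //.
  by case: eqP => [/= -> | ].
by rewrite -val_eqE /= in xi; rewrite -val_eqE /= in xi'; rewrite (negPf xi) (negPf xi').
Qed.

Lemma oppr_id_eq0 (p : {poly int}) : p = - p -> p = 0.
Proof.
move/eqP; rewrite -addr_eq0 -mulr2n -mulr_natr mulf_eq0 => /orP[/eqP //|].
by rewrite -polyC_natr polyC_eq0.
Qed.

(* Composition with [tperm i i'] negates the terms in which neither of the two
   letters is [i + 2], and exchanges the two kinds of remaining terms. *)
Lemma sum_pair (n : nat) (i i' : 'I_n) (P : pred 'S_n) (H : 'S_n -> {poly int}) :
    i' = i.+1 :> nat ->
    (forall s, P (tperm i i' * s)%g = P s) ->
    (forall s, H (tperm i i' * s)%g = H s) ->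
  \sum_(s | P s) H s * pair_weight i.+1 (oneline s i.+1) (oneline s i.+2) =
  \sum_(s | P s && (oneline s i.+2 == i.+2))
     H s * ((1 + 'X) * 'X ^+ (i.+1 < oneline s i.+1)%N).
Proof.
move=> ii' Pt Ht; have in' : (i.+1 < n)%N by rewrite -ii'.
have ut s : oneline (tperm i i' * s)%g i.+1 = oneline s i.+2.
  by rewrite oneline_tperm // eqxx ii'.
have vt s : oneline (tperm i i' * s)%g i.+2 = oneline s i.+1.
  by rewrite oneline_tperm // ii' eqxx; case: eqP => // /esym/n_Sn.
have uv (s : 'S_n) : oneline s i.+1 != oneline s i.+2.
  by apply/eqP => /(@oneline_inj _ _ i.+1 i.+2 (ltn_ord i) in') /n_Sn.
have tK : involutive (fun s : 'S_n => (tperm i i' * s)%g).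
  by move=> s; rewrite mulgA tperm2 mul1g.
have reidx (Q : pred 'S_n) (F : 'S_n -> {poly int}) : \sum_(s | Q s) F s =
    \sum_(s | Q (tperm i i' * s)%g) F (tperm i i' * s)%g :> {poly int}.
  exact: reindex_inj (inv_inj tK).
rewrite (bigID (fun s => oneline s i.+2 == i.+2)) /=.
rewrite [X in _ + X](bigID (fun s => oneline s i.+1 == i.+2)) /=.
rewrite [X in _ + (_ + X)](_ : _ = 0) ?addr0; last first.
  apply: oppr_id_eq0; rewrite {1}reidx -sumrN; apply: eq_big => [s|s].
    by rewrite Pt ut vt -!andbA; congr andb; rewrite andbC.
  rewrite ut vt => /andP[/andP[_ h] h'].
  by rewrite Ht pair_weightC ?mulrN.
rewrite [X in _ + X]reidx [X in _ + X](eq_bigl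
    (fun s => P s && (oneline s i.+2 == i.+2))); last first.
  move=> s; rewrite Pt ut vt -andbA; congr andb; apply: andb_idl => /eqP <-.
  exact: uv.
rewrite -big_split; apply: eq_bigr => s /andP[_ /eqP Ev] /=.
have := uv s; rewrite Ev => uk.
by rewrite Ht ut vt Ev -mulrDr pair_weight_key.
Qed.

Definition fixes_evens (n k : nat) (s : 'S_n) : bool :=
  all (fun j => oneline s j.*2.+2 == j.*2.+2) (iota 0 k).

(** One pair is treated at a time by [sum_pair]: exchanging its letters affects neither the even
    letters already fixed nor the factors [H] of the other pairs. *)
Lemma sum_pair_weights (n k : nat) : (k <= n./2)%N ->
  \sum_(s : 'S_n) \prod_(0 <= j < n./2)
     pair_weight j.*2.+1 (oneline s j.*2.+1) (oneline s j.*2.+2) =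
  \sum_(s : 'S_n | fixes_evens n k s)
    (\prod_(0 <= j < k) ((1 + 'X) * 'X ^+ (j.*2.+1 < oneline s j.*2.+1)%N) *
     \prod_(k <= j < n./2)
       pair_weight j.*2.+1 (oneline s j.*2.+1) (oneline s j.*2.+2)).
Proof.
elim: k => [_|k IH kn].
  by apply: eq_big => // s _; rewrite [X in X * _]big_geq ?mul1r.
rewrite (IH (ltnW kn)).
have in' : (k.*2.+1 < n)%N by lia.
pose i := Ordinal (ltnW in'); pose i' := Ordinal in'.
have tx (s : 'S_n) x : (x < n)%N -> (x != k.*2)%N -> (x != k.*2.+1)%N ->
    oneline (tperm i i' * s)%g x.+1 = oneline s x.+1.
  by move=> xn xi xi'; rewrite oneline_tperm // (negPf xi) (negPf xi').
pose H (s : 'S_n) : {poly int} :=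
  \prod_(0 <= j < k) ((1 + 'X) * 'X ^+ (j.*2.+1 < oneline s j.*2.+1)%N) *
  \prod_(k.+1 <= j < n./2)
       pair_weight j.*2.+1 (oneline s j.*2.+1) (oneline s j.*2.+2).
rewrite (eq_bigr (fun s => H s * pair_weight i.+1 (oneline s i.+1) (oneline s i.+2))); last first.
  by move=> s _; rewrite [X in _ * X]big_ltn // mulrCA mulrC.
rewrite (sum_pair n i i') //=.
- apply: eq_big => s; first by rewrite /fixes_evens -[k.+1]addn1 iotaD all_cat /= andbT.
  by move=> _; rewrite big_nat_recr //= mulrAC.
- move=> s; apply: eq_in_all => j; rewrite mem_iota => /= jk.
  by rewrite tx //; lia.
move=> s; congr (_ * _); apply: eq_big_nat => j jk.
  by rewrite tx //; lia.
by rewrite !tx //; lia.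
Qed.

(** * Permutations of the odd letters *)

Lemma half_ord_proof (n : nat) (i : 'I_n) : (i./2 < uphalf n)%N.
Proof. by have := ltn_ord i; lia. Qed.

Lemma double_ord_proof (n : nat) (j : 'I_(uphalf n)) : (j.*2 < n)%N.
Proof. by have := ltn_ord j; lia. Qed.

Definition half_ord (n : nat) (i : 'I_n) : 'I_(uphalf n) := Ordinal (half_ord_proof n i).

Definition double_ord (n : nat) (j : 'I_(uphalf n)) : 'I_n := Ordinal (double_ord_proof n j).

(** Indices start at 0, so odd indices stand for even letters. *)
Definition stretch_fun (n : nat) (s : 'S_(uphalf n)) (i : 'I_n) : 'I_n :=
  if odd i then i else double_ord n (s (half_ord n i)).

Lemma stretch_fun_inj (n : nat) (s : 'S_(uphalf n)) : injective (stretch_fun n s).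
Proof.
move=> i j /(congr1 val); rewrite /stretch_fun.
case: (boolP (odd i)) (boolP (odd j)) => oi [] oj //=.
- exact: val_inj.
- by move=> E; rewrite E odd_double in oi.
- by move=> E; rewrite -E odd_double in oj.
move/double_inj/val_inj/perm_inj/(congr1 val) => /= E; apply: val_inj => /=.
by rewrite -(even_halfK oi) E even_halfK.
Qed.

(* Fixes the even letters of {1,...,n}, and permutes the odd ones as [s]
   permutes {1,...,ceil(n/2)}. *)
Definition stretch (n : nat) (s : 'S_(uphalf n)) : 'S_n := perm (stretch_fun_inj n s).

Lemma stretch_inj (n : nat) : injective (stretch n).
Proof.
move=> s t st; apply/permP => j; apply: val_inj; apply: double_inj.
have := congr1 (fun u : 'S_n => val (u (double_ord n j))) st.
rewrite /= !permE /stretch_fun /= odd_double /=.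
by rewrite (_ : half_ord n (double_ord n j) = j) //; apply: val_inj; rewrite /= doubleK.
Qed.

Lemma oneline_stretch_odd (n : nat) (s : 'S_(uphalf n)) (j : nat) : (j < n./2)%N ->
  oneline (stretch n s) j.*2.+1 = (oneline s j.+1).*2.-1.
Proof.
move=> jn; have jn1 : (j < uphalf n)%N by lia.
rewrite (onelineE _ _ (double_ord n (Ordinal jn1))) (onelineE _ _ (Ordinal jn1)).
rewrite permE /stretch_fun /= odd_double /=.
by rewrite (_ : half_ord n _ = Ordinal jn1) //; apply: val_inj; rewrite /= doubleK.
Qed.

(** A permutation that fixes all odd indices maps even indices to even ones by injectivity; halving
    these gives the preimage under [stretch]. *)
Lemma fixes_evens_stretch (n : nat) :
  [set s : 'S_n | fixes_evens n n./2 s] = [set stretch n s | s in [set: 'S_(uphalf n)]].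
Proof.
apply/setP => s; rewrite inE; apply/idP/imsetP => [/allP fs | [t _ ->]]; last first.
  apply/allP => j; rewrite mem_iota add0n => jn.
  have jn1 : (j.*2.+1 < n)%N by lia.
  by rewrite (onelineE _ _ (Ordinal jn1)) permE /stretch_fun /= odd_double.
have fix_odd (i : 'I_n) : odd i -> s i = i.
  move=> oi; have := fs i./2; rewrite mem_iota add0n.
  have -> : ((i./2).*2.+2 = i.+2.-1)%N by have := odd_double_half i; lia.
  move=> /(_ ltac:(have := ltn_ord i; lia)); rewrite onelineE eqSS => /eqP.
  exact: val_inj.
have even_even (i : 'I_n) : ~~ odd i -> ~~ odd (s i).
  by apply: contra => osi; move/perm_inj: (fix_odd _ osi) => <-.
have g_inj : injective (fun j : 'I_(uphalf n) => half_ord n (s (double_ord n j))).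
  have ev j : ~~ odd (s (double_ord n j)) by rewrite even_even //= odd_double.
  move=> j k /(congr1 val) /= E; apply: val_inj; apply: double_inj.
  suff /perm_inj /(congr1 val) : s (double_ord n j) = s (double_ord n k) by [].
  by apply: val_inj; rewrite /= -(even_halfK (ev j)) E even_halfK.
exists (perm g_inj) => //; apply/permP => i; apply: val_inj.
rewrite permE /stretch_fun; case: (boolP (odd i)) => oi; first by rewrite fix_odd.
rewrite permE /= (_ : double_ord n _ = i) ?even_halfK ?even_even //.
by apply: val_inj; rewrite /= even_halfK.
Qed.

Lemma exc_uphalf (n : nat) (s : 'S_(uphalf n)) :
  exc s = (\sum_(0 <= j < n./2) (j.*2.+1 < oneline (stretch n s) j.*2.+1))%N.
Proof.
have -> : exc s = (\sum_(1 <= i < n./2.+1) (i < oneline s i))%N.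
  have -> : exc s = (\sum_(1 <= i < uphalf n) (i < oneline s i))%N.
    by rewrite /exc -sum1_count big_mkcond; apply: eq_bigr => i _; case: (_ < _)%N.
  (* For even [n] the additional position [uphalf n] is the last one, never an excedance. *)
  have [<- //|E] : uphalf n = n./2.+1 \/ uphalf n = n./2 by lia.
  rewrite -E; have [N0|N0] := posnP (uphalf n).
    by rewrite !big_geq ?N0.
  by rewrite [RHS]big_nat_recr //= [(uphalf n < _)%N]ltnNge oneline_le addn0.
rewrite big_add1 /=; apply: eq_big_nat => j /andP[_ jn].
rewrite oneline_stretch_odd //.
have o0 : (0 < oneline s j.+1)%N.
  have jn1 : (j < uphalf n)%N by lia.
  by rewrite (onelineE _ _ (Ordinal jn1)).
by congr nat_of_bool; lia.
Qed.

(** The sum is kept in place of [eulerian], because at [n = 0] it is 1 whereas [eulerian 0] is 0. *)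
Lemma eval_eulerian_q_half (n : nat) :
  eval_q (-1) (eulerian_q n) =
    (1 + 'X) ^+ n./2 * \sum_(s : 'S_(uphalf n)) 'X^(des s).
Proof.
rewrite eval_eulerian_q (sum_pair_weights n n./2) // sum_des_exc.
rewrite (eq_bigl (mem [set stretch n s | s in [set: 'S_(uphalf n)]])); last first.
  by move=> s; rewrite /= -fixes_evens_stretch inE.
rewrite big_imset /=; last by move=> s t _ _; apply: stretch_inj.
rewrite big_distrr /= (eq_bigl predT) => [|s]; last by rewrite inE.
apply: eq_bigr => s _; rewrite [X in _ * X]big_geq // mulr1 big_split /=.
by rewrite prodr_const_nat subn0 prodrXr -exc_uphalf.
Qed.

(** * Evaluation of the full sum *)

Lemma eval_eulerian_q_even (m : nat) : (0 < m)%N ->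
  eval_q (-1) (eulerian_q m.*2) = (1 + 'X) ^+ m * eulerian m.
Proof.
by case: m => // m _; rewrite eval_eulerian_q_half /eulerian /= doubleK uphalf_double.
Qed.

Lemma eval_eulerian_q_odd (m : nat) :
  eval_q (-1) (eulerian_q m.*2.+1) = (1 + 'X) ^+ m * eulerian m.+1.
Proof. by rewrite eval_eulerian_q_half /eulerian /= doubleK uphalf_double. Qed.

Lemma eval_eulerian_tilde (n : nat) :
  eval_q (-1) (eulerian_tilde n) =
    1 + 'X * \sum_(1 <= m < n.+1)
      ((~~ odd m || odd n) * 'C(n./2, m./2))%N%:R * eval_q (-1) (eulerian_q m).
Proof.
rewrite /eval_q /eulerian_tilde rmorphD rmorph1 rmorphM rmorph_sum /= map_polyX.
congr (_ + _ * _); apply: eq_bigr => m _.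
by rewrite map_polyZ /= horner_evalE qbinomN1 -mul_polyC polyC_natr.
Qed.

Lemma sum_even_odd (R : nmodType) (F : nat -> R) (m : nat) :
  \sum_(0 <= i < m.*2) F i = \sum_(0 <= j < m) (F j.*2 + F j.*2.+1).
Proof.
elim: m => [|m IH]; first by rewrite !big_geq.
by rewrite [RHS]big_nat_recr //= -IH doubleS !(@big_nat_recr _ _ _ _ 0) //= addrA.
Qed.

Theorem corollary2p3 (n : nat) (hn : (1 <= n)%N) :
  (forall m : nat, n = (2 * m)%N ->
     eval_q (-1) (eulerian_tilde n) =
       1 + 'X * \sum_(1 <= k < m.+1) ('C(m, k))%:R * (1 + 'X) ^+ k * eulerian k)
  /\
  (forall m : nat, n = (2 * m + 1)%N ->
     eval_q (-1) (eulerian_tilde n) =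
       1 + 'X * \sum_(0 <= k < m.+1)
                  ('C(m, k))%:R * (1 + 'X) ^+ k * (eulerian k + eulerian k.+1)).
Proof.
split=> m ->; rewrite mul2n ?addn1 eval_eulerian_tilde /= odd_double /=.
  rewrite doubleK; congr (_ + _ * _).
  (* After the shift, each consecutive pair of terms has indices 2k+1 and 2k+2, and the first
     vanishes since [n] is even. *)
  transitivity (\sum_(0 <= i < m.*2)
    ((~~ odd i.+1 || false) * 'C(m, i.+1./2))%N%:R * eval_q (-1) (eulerian_q i.+1)).
    by rewrite big_add1.
  rewrite sum_even_odd big_add1; apply: eq_bigr => k _.
  rewrite /= odd_double /= mul0n mul0r add0r mul1n doubleK.
  by rewrite -doubleS eval_eulerian_q_even // mulrA.
rewrite uphalf_double; congr (_ + _ * _).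
(* A zero term at index 0 lets 2k pair with 2k+1, which share the coefficient ['C(m, k)]; it matches
   the convention [eulerian 0 = 0]. *)
pose F i := if i == 0%N then 0 else ('C(m, i./2))%:R * eval_q (-1) (eulerian_q i).
transitivity (\sum_(0 <= i < m.+1.*2) F i).
  rewrite doubleS [RHS]big_ltn // add0r; apply: eq_big_nat => i /andP[i0 _].
  by rewrite orbT mul1n /F gtn_eqF.
rewrite sum_even_odd; apply: eq_bigr => k _.
rewrite /F /= uphalf_double doubleK eval_eulerian_q_odd mulrDr -!mulrA; congr (_ + _).
case: k => [|k]; first by rewrite /eulerian eqxx !mulr0.
by rewrite doubleS /= -doubleS eval_eulerian_q_even.
Qed.
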